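(* Let $\mathbf S:\mathbb R^N\to\mathbb R^N$ be continuously differentiable with Jacobian $\nabla\mathbf S(\mathbf z)$ and zero set $\mathcal S=\{\mathbf z:\mathbf S(\mathbf z)=\mathbf 0\}$, let $V(\mathbf z)=\tfrac12\|\mathbf S(\mathbf z)\|^2$, and let $\mathcal U\subseteq\mathbb R^N$ be an open set with $\mathcal S\subseteq\mathcal U$ such that $\nabla\mathbf S(\mathbf z)$ is invertible for every $\mathbf z\in\mathcal U$. Let $\sigma(V,t)$ be any of the decay laws (Exp), (FT), (FxT), (PT) listed in the context, and set $\lambda(V,t)=\sigma(V,t)/(2V)$. Then for every $\mathbf z\in\mathcal U$ with $V(\mathbf z)\ne0$ and every admissible $t$, the feedback $$\mathbf u(\mathbf z,t)=-\lambda(V(\mathbf z),t)\,\nabla\mathbf S(\mathbf z)^{-1}\mathbf S(\mathbf z)$$ for the system $\dot{\mathbf z}=\mathbf u$ satisfies $$\dot V(\mathbf z,t)=\nabla V(\mathbf z)^\top\mathbf u(\mathbf z,t)=-\sigma(V(\mathbf z),t).$$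
   Context: $\nabla\mathbf S(\mathbf z)$ denotes the Jacobian matrix $\partial\mathbf S/\partial\mathbf z$, so $\nabla V(\mathbf z)=\nabla\mathbf S(\mathbf z)^\top\mathbf S(\mathbf z)$. For $\dot{\mathbf z}=\mathbf u(\mathbf z,t)$ one writes $\dot V(\mathbf z,t)=\nabla V(\mathbf z)^\top\mathbf u(\mathbf z,t)$. Decay laws: $\sigma(V,t)$ is one of (Exp) $c\,V$; (FT) $k\,V^{\gamma}$ with $0<\gamma<1$; (FxT) $a\,V^{\gamma}+b\,V^{\delta}$ with $0<\gamma<1<\delta$; (PT) $\frac{\mu}{T-t}V$ for $t\in[0,T)$; where $a,b,c,k,\mu,T$ are positive constants. Admissible times are $t\ge0$ in the first three cases and $t\in[0,T)$ in the (PT) case. *)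

(* Defs.v *)
From mathcomp Require Import all_boot all_order all_algebra.
From mathcomp Require Import all_classical all_reals all_analysis.
Set Implicit Arguments.
Unset Strict Implicit.
Unset Printing Implicit Defensive.
Import Order.TTheory GRing.Theory Num.Theory.
Import numFieldNormedType.Exports.
Local Open Scope classical_set_scope.
Local Open Scope ring_scope.

(* Points of R^N are column vectors 'cV[R]_N.  The library norm `|x| on
   matrices is the sup norm, so the Euclidean norm is introduced here; the
   topology is the same. *)
Definition enorm (R : realType) (N : nat) (x : 'cV[R]_N) : R :=
  Num.sqrt (\sum_(i < N) x i 0 ^+ 2).

Definition partial (R : realType) (N : nat) (f : 'cV[R]_N -> R) (j : 'I_N)
    (z : 'cV[R]_N) : R :=
  'D_(delta_mx j 0) f z.

Definition grad (R : realType) (N : nat) (f : 'cV[R]_N -> R)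
    (z : 'cV[R]_N) : 'cV[R]_N :=
  \col_j partial f j z.

(* Usual convention: row i, column j holds dS_i/dz_j.  The library's [jacobian]
   is the transpose of this and is restricted to row vectors. *)
Definition Jac (R : realType) (N : nat) (S : 'cV[R]_N -> 'cV[R]_N)
    (z : 'cV[R]_N) : 'M[R]_N :=
  \matrix_(i, j) partial (fun x => S x i 0) j z.

Definition continuously_differentiable (R : realType) (N : nat)
    (S : 'cV[R]_N -> 'cV[R]_N) : Prop :=
  (forall z, differentiable S z) /\ continuous (Jac S).

Definition zero_set (R : realType) (N : nat) (S : 'cV[R]_N -> 'cV[R]_N) :
    set 'cV[R]_N :=
  [set z | S z = 0].

Definition lyapunov (R : realType) (N : nat) (S : 'cV[R]_N -> 'cV[R]_N)
    (z : 'cV[R]_N) : R :=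
  2^-1 * enorm (S z) ^+ 2.

Inductive decay_law (R : realType) : Type :=
  | Exp (c : R)
  | FT (k gamma : R)
  | FxT (a gamma b delta : R)
  | PT (mu T : R).

Definition decay_law_valid (R : realType) (l : decay_law R) : Prop :=
  match l with
  | Exp c => 0 < c
  | FT k gamma => 0 < k /\ 0 < gamma < 1
  | FxT a gamma b delta => [/\ 0 < a, 0 < b, 0 < gamma < 1 & 1 < delta]
  | PT mu T => 0 < mu /\ 0 < T
  end.

Definition admissible_time (R : realType) (l : decay_law R) (t : R) : Prop :=
  match l with
  | PT _ T => 0 <= t < T
  | _ => 0 <= t
  end.

Definition sigma (R : realType) (l : decay_law R) (V t : R) : R :=
  match l with
  | Exp c => c * V
  | FT k gamma => k * V `^ gamma
  | FxT a gamma b delta => a * V `^ gamma + b * V `^ delta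
  | PT mu T => mu / (T - t) * V
  end.

Definition lambda (R : realType) (l : decay_law R) (V t : R) : R :=
  sigma l V t / (2 * V).

Definition feedback (R : realType) (N : nat) (S : 'cV[R]_N -> 'cV[R]_N)
    (l : decay_law R) (z : 'cV[R]_N) (t : R) : 'cV[R]_N :=
  - lambda l (lyapunov S z) t *: (invmx (Jac S z) *m S z).

(* Derivative of V along the system z' = u(z, t). *)
Definition orbital_derivative (R : realType) (N : nat) (V : 'cV[R]_N -> R)
    (u : 'cV[R]_N -> R -> 'cV[R]_N) (z : 'cV[R]_N) (t : R) : R :=
  ((grad V z)^T *m u z t) 0 0.

(* Main.v *)
Require Import Defs.
From mathcomp Require Import all_boot all_order all_algebra.
From mathcomp Require Import all_classical all_reals all_analysis.
Set Implicit Arguments.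
Unset Strict Implicit.
Unset Printing Implicit Defensive.
Import Order.TTheory GRing.Theory Num.Theory.
Import numFieldNormedType.Exports.
Local Open Scope classical_set_scope.
Local Open Scope ring_scope.

(** Since V = (S^T S)/2, Leibniz' rule gives grad V = J^T S, so along any field
    u one has V' = S^T J u.  A feedback u = a J^-1 S cancels the Jacobian and
    leaves V' = a S^T S = 2 a V, which is - sigma for the gain a = - lambda. *)

Section MatrixDerivatives.
Variables (R : realFieldType) (V : normedModType R).
Implicit Types x v : V.

Lemma is_derive_mxP m n (M : V -> 'M[R]_(m, n)) x v (dM : 'M[R]_(m, n)) :
  is_derive x v M dM <->
  forall i j, is_derive x v (fun y => M y i j) (dM i j).
Proof.
split=> [[/[dup] Mx /derivable_mxP Mijx <-] i j|Mx].
  by rewrite derive_mx// mxE; exact: derivableP.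
have Mx_derivable : derivable M x v by apply/derivable_mxP => i j.
apply: DeriveDef => //; apply/matrixP => i j.
by rewrite derive_mx// mxE derive_val.
Qed.

Lemma is_derive_trmx m n (M : V -> 'M[R]_(m, n)) x v (dM : 'M[R]_(m, n)) :
  is_derive x v M dM -> is_derive x v (fun y => (M y)^T) dM^T.
Proof.
move/is_derive_mxP => Mx; apply/is_derive_mxP => i j; rewrite mxE.
by under eq_fun do rewrite mxE.
Qed.

Lemma is_derive_mulmx m n p (A : V -> 'M[R]_(m, n)) (B : V -> 'M[R]_(n, p))
    x v (dA : 'M[R]_(m, n)) (dB : 'M[R]_(n, p)) :
  is_derive x v A dA -> is_derive x v B dB ->
  is_derive x v (fun y => A y *m B y) (A x *m dB + dA *m B x).
Proof.
move=> /is_derive_mxP Ax /is_derive_mxP Bx; apply/is_derive_mxP => i j.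
have -> : (fun y => (A y *m B y) i j) =
    \sum_(k < n) (fun y => A y i k) * (fun y => B y k j).
  by apply/funext => y; rewrite mxE fct_sumE.
apply: is_derive_eq; rewrite !mxE -big_split; apply: eq_bigr => k _ /=.
by congr (_ + _); exact: mulrC.
Qed.

End MatrixDerivatives.

Lemma tr_mul_cVC (R : comPzSemiRingType) (n : nat) (x y : 'cV[R]_n) :
  x^T *m y = y^T *m x.
Proof.
apply/matrixP => i j; rewrite !ord1 !mxE.
by apply: eq_bigr => k _; rewrite !mxE mulrC.
Qed.

Lemma sqr_enorm (R : realType) (N : nat) (x : 'cV[R]_N) :
  enorm x ^+ 2 = (x^T *m x) 0 0.
Proof.
rewrite sqr_sqrtr ?sumr_ge0// => [|i _]; last exact: sqr_ge0.
by rewrite mxE; apply: eq_bigr => i _; rewrite mxE expr2.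
Qed.

Section Lyapunov.
Variables (R : realType) (N : nat) (S : 'cV[R]_N -> 'cV[R]_N).
Implicit Types (z v : 'cV[R]_N) (u : 'cV[R]_N -> R -> 'cV[R]_N).

Lemma is_derive_lyapunov z v (dS : 'cV[R]_N) :
  is_derive z v S dS ->
  is_derive z v (lyapunov S) ((dS^T *m S z) 0 0).
Proof.
move=> Sz.
have -> : lyapunov S = 2^-1 \*: (fun y => ((S y)^T *m S y) 0 0).
  by apply/funext => y; rewrite /lyapunov sqr_enorm.
have /is_derive_mxP/(_ 0 0) dSS := is_derive_mulmx (is_derive_trmx Sz) Sz.
apply: is_derive_eq.
rewrite tr_mul_cVC mxE -mulr2n -scalerMnr scalerMnl -mulr_natr.
by rewrite mulVf ?scale1r// pnatr_eq0.
Qed.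

Lemma col_Jac z (j : 'I_N) :
  derivable S z (delta_mx j 0) -> col j (Jac S z) = 'D_(delta_mx j 0) S z.
Proof. by move=> Sz; apply/colP => i; rewrite derive_mx// !mxE. Qed.

Lemma grad_lyapunov z :
  (forall j, derivable S z (delta_mx j 0)) ->
  grad (lyapunov S) z = (Jac S z)^T *m S z.
Proof.
move=> Sz; apply/colP => j.
have dV := is_derive_lyapunov (derivableP (Sz j)).
by rewrite mxE /partial derive_val -col_Jac// tr_col -row_mul mxE.
Qed.

Lemma orbital_derivative_lyapunov u z t :
  (forall j, derivable S z (delta_mx j 0)) ->
  orbital_derivative (lyapunov S) u z t =
    ((S z)^T *m (Jac S z *m u z t)) 0 0.
Proof.
move=> Sz.
by rewrite /orbital_derivative grad_lyapunov// trmx_mul trmxK mulmxA.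
Qed.

Lemma orbital_derivative_lyapunov_newton u (a : R) z t :
  (forall j, derivable S z (delta_mx j 0)) -> Jac S z \in unitmx ->
  u z t = a *: (invmx (Jac S z) *m S z) ->
  orbital_derivative (lyapunov S) u z t = a * (2 * lyapunov S z).
Proof.
move=> Sz Jz uzt; rewrite orbital_derivative_lyapunov// uzt.
rewrite -!scalemxAr mulKVmx// mxE /lyapunov sqr_enorm.
by rewrite mulVKf// pnatr_eq0.
Qed.

End Lyapunov.

Theorem mainTheorem2 (R : realType) (N : nat) (S : 'cV[R]_N -> 'cV[R]_N)
    (U : set 'cV[R]_N) (l : decay_law R)
    (S_C1 : continuously_differentiable S)
    (U_open : open U)
    (zero_set_U : zero_set S `<=` U)
    (Jac_inv : forall z : 'cV[R]_N, U z -> Jac S z \in unitmx)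
    (l_valid : decay_law_valid l)
    (z : 'cV[R]_N) (Uz : U z) (Vz_neq0 : lyapunov S z <> 0)
    (t : R) (t_adm : admissible_time l t) :
  orbital_derivative (lyapunov S) (feedback S l) z t =
    - sigma l (lyapunov S z) t.
Proof.
have S_partial j : derivable S z (delta_mx j 0).
  by apply: diff_derivable; case: S_C1.
have uE : feedback S l z t =
    - lambda l (lyapunov S z) t *: (invmx (Jac S z) *m S z) by [].
rewrite (orbital_derivative_lyapunov_newton S_partial (Jac_inv z Uz) uE).
rewrite mulNr /lambda divfK//.
by rewrite mulf_neq0 ?pnatr_eq0//; exact/eqP.
Qed.
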